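(* Let $R$ be a ring with identity, let $M$ be an $R$-module, let $n\ge 0$, and let $$P_n \xrightarrow{\partial_n} P_{n-1}\to\cdots \xrightarrow{\partial_2} P_1 \xrightarrow{\partial_1} P_0 \xrightarrow{\epsilon} M \to 0$$ and $$Q_n \xrightarrow{\partial_n'} Q_{n-1}\to\cdots \xrightarrow{\partial_2'} Q_1 \xrightarrow{\partial_1'} Q_0 \xrightarrow{\epsilon'} M \to 0$$ be exact sequences of $R$-modules with all $P_i$ and $Q_i$ projective. Define modules $R_i,S_i$ for $0\le i\le n$ recursively by $R_0=P_0$, $S_0=Q_0$, and $R_i=S_{i-1}\oplus P_i$, $S_i=R_{i-1}\oplus Q_i$ for $1\le i\le n$. Then the complexes $$P_n\oplus S_n \xrightarrow{\partial_n\oplus 0} P_{n-1}\xrightarrow{\partial_{n-1}}\cdots\xrightarrow{\partial_2} P_1\xrightarrow{\partial_1} P_0$$ and $$Q_n\oplus R_n \xrightarrow{\partial_n'\oplus 0} Q_{n-1}\xrightarrow{\partial_{n-1}'}\cdots\xrightarrow{\partial_2'} Q_1\xrightarrow{\partial_1'} Q_0$$ are chain homotopy equivalent over $R$.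
   Context: Modules are right modules and maps are $R$-linear. For $f:A\to C$ and $g:B\to C$, the map $f\oplus g:A\oplus B\to C$ is $(f\oplus g)(a\oplus b)=f(a)+g(b)$. The module $M$ is not part of the two displayed complexes in the conclusion; the terms lie in degrees $n,n-1,\dots,0$ and all other terms are zero. *)

(* Defs.v *)
From HB Require Import structures.
From mathcomp Require Import all_boot all_algebra.
Set Implicit Arguments.
Unset Strict Implicit.
Unset Printing Implicit Defensive.
Import GRing.Theory.
Local Open Scope ring_scope.

(* A right R-module is a left module over the converse ring R^c, where         *)
(* (a : R^c) *: v stands for v a. The definitions below never mention scalars  *)
(* and are written for left modules over an arbitrary ring.                    *)
Notation rmodType R := (lmodType R^c).

Section Modules.
Variable R : pzRingType.

Definition surjective (A B : lmodType R) (f : A -> B) : Prop :=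
  forall b, exists a, f a = b.

Definition projective (P : lmodType R) : Prop :=
  forall (A B : lmodType R) (f : {linear A -> B}) (g : {linear P -> B}),
    surjective f -> exists h : {linear P -> A}, forall x, f (h x) = g x.

(* A -f-> B -g-> C is exact at B *)
Definition exact_at (A B C : lmodType R) (f : A -> B) (g : B -> C) : Prop :=
  forall b, g b = 0 <-> exists a, f a = b.

Definition zero_module : lmodType R := 'rV[R]_0.

Definition map_oplus (A B C : lmodType R) (f : {linear A -> C})
  (g : {linear B -> C}) (x : (A * B)%type) : C := f x.1 + g x.2.

Lemma map_oplus_is_linear (A B C : lmodType R) (f : {linear A -> C})
  (g : {linear B -> C}) : linear (map_oplus f g).
Proof.
by move=> a x y; rewrite /map_oplus /= !linearP scalerDr addrACA.
Qed.

HB.instance Definition _ (A B C : lmodType R) (f : {linear A -> C})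
  (g : {linear B -> C}) :=
  GRing.isLinear.Build R (A * B)%type C _ (map_oplus f g)
    (map_oplus_is_linear f g).

End Modules.

Section Complexes.
Variable R : pzRingType.

(* Nonnegatively graded: the terms in negative degrees are zero.               *)
(* [cdiff C k] is the differential from degree k+1 to degree k.                *)
Record chain_complex := ChainComplex {
  cterm :> nat -> lmodType R;
  cdiff : forall k, {linear cterm k.+1 -> cterm k};
  cdiffK : forall k x, cdiff k (cdiff k.+1 x) = 0 }.

Record chain_map (C D : chain_complex) := ChainMap {
  cmap :> forall k, {linear C k -> D k};
  cmapE : forall k x, cmap k (cdiff C k x) = cdiff D k (cmap k.+1 x) }.

(* [chain_homotopic u v] compares degreewise maps, so that it applies directly *)
(* to composites and identities.                                               *)
Definition chain_homotopic (C D : chain_complex) (u v : forall k, C k -> D k) :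
    Prop :=
  exists h : forall k, {linear C k -> D k.+1},
    (forall x, u 0%N x - v 0%N x = cdiff D 0%N (h 0%N x)) /\
    (forall k x, u k.+1 x - v k.+1 x =
       cdiff D k.+1 (h k.+1 x) + h k (cdiff C k x)).

Definition homotopy_equivalent (C D : chain_complex) : Prop :=
  exists (f : chain_map C D) (g : chain_map D C),
    chain_homotopic (fun k x => g k (f k x)) (fun k x => x) /\
    chain_homotopic (fun k x => f k (g k x)) (fun k x => x).

End Complexes.

Section Sequences.
Variable R : pzRingType.
Implicit Types (P Q : nat -> lmodType R) (M S : lmodType R).

(* Sequences of modules are indexed by nat, but only the modules P i with      *)
(* i <= n and the maps d i with i < n are used: d i : P (i+1) -> P i is the    *)
(* boundary map with subscript i+1.                                            *)

(* P n -> ... -> P 1 -> P 0 -eps-> M -> 0 is exact; nothing is required        *)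
(* at P n, except surjectivity of eps when n = 0.                              *)
Definition exact_seq n P (d : forall i, {linear P i.+1 -> P i}) M
    (eps : {linear P 0%N -> M}) : Prop :=
  [/\ surjective eps,
      0 < n -> exact_at (d 0) eps
    & forall i, i.+1 < n -> exact_at (d i.+1) (d i)]%N.

Fixpoint altR P Q i : lmodType R :=
  match i with
  | 0 => P 0%N
  | j.+1 => (altS P Q j * P j.+1)%type
  end
with altS P Q i : lmodType R :=
  match i with
  | 0 => Q 0%N
  | j.+1 => (altR P Q j * Q j.+1)%type
  end.

(* The terms and differentials of                                              *)
(*   P n (+) S -> P (n-1) -> ... -> P 0                                        *)
(* by recursion on n, peeling off P 0 and shifting P; the first differential   *)
(* is d (n-1) (+) 0. For n = 0 this is P 0 (+) S in degree 0.                  *)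
Fixpoint capped_term n P S k : lmodType R :=
  match n, k with
  | 0, 0 => (P 0%N * S)%type
  | 0, _.+1 => zero_module R
  | _.+1, 0 => P 0%N
  | m.+1, j.+1 => capped_term m (fun i => P i.+1) S j
  end.

Fixpoint capped_diff n P (d : forall i, {linear P i.+1 -> P i}) S k :
    {linear capped_term n P S k.+1 -> capped_term n P S k} :=
  match n, k with
  | 0, _ => \0
  | 1, 0 => map_oplus (d 0%N) \0
  | _.+2, 0 => d 0%N
  | m.+1, j.+1 => capped_diff m (fun i => d i.+1) S j
  end.

Lemma capped_term_lt n P S k : (k < n)%N -> capped_term n P S k = P k.
Proof. by elim: n P k => [|n IHn] P [|k] //= /IHn->. Qed.

Lemma capped_term_top n P S : capped_term n P S n = (P n * S)%type.
Proof. by elim: n P => [|n IHn] P //=; rewrite IHn. Qed.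

Lemma capped_term_gt n P S k : (n < k)%N -> capped_term n P S k = zero_module R.
Proof. by elim: n P k => [|n IHn] P [|k] //= /IHn->. Qed.

Lemma capped_diffK n P (d : forall i, {linear P i.+1 -> P i}) M
    (eps : {linear P 0%N -> M}) S :
  exact_seq n d eps ->
  forall k x, capped_diff n d S k (capped_diff n d S k.+1 x) = 0.
Proof.
case=> _ _ ex.
have {ex}: forall i, (i.+1 < n)%N -> forall x, d i (d i.+1 x) = 0.
  by move=> i lt_in x; apply/(ex i lt_in); exists x.
elim: n P d {M eps} => [|n IHn] P d dK k x /=; first by rewrite raddf0.
case: k x => [|k] x; last first.
  by case: n IHn dK x => [|n] IHn dK x; apply: (IHn _ (fun i => d i.+1)) => i lt_in;
     apply: dK.
case: n {IHn} dK x => [|[|n]] dK x /=.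
- by rewrite /map_oplus /= linear0 addr0.
- by rewrite /map_oplus /= addr0 dK.
- by rewrite dK.
Qed.

Definition capped_complex n P (d : forall i, {linear P i.+1 -> P i}) M
    (eps : {linear P 0%N -> M}) (exP : exact_seq n d eps) S : chain_complex R :=
  ChainComplex (capped_diffK (S := S) exP).

End Sequences.

(* Main.v *)
Require Import Defs.
From HB Require Import structures.
From mathcomp Require Import all_boot all_algebra.
Set Implicit Arguments.
Unset Strict Implicit.
Unset Printing Implicit Defensive.
Import GRing.Theory.
Local Open Scope ring_scope.

(** The idea is to enlarge both complexes by contractible summands until they
    become isomorphic.  Write R_k and S_k for the modules of the statement, so
    that R_k = S_(k-1) (+) P_k and S_k = R_(k-1) (+) Q_k.  Adding to
      P_n (+) S_n -> P_(n-1) -> ... -> P_0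
    one trivial complex S_k = S_k in degrees k+1 and k, for every k < n, gives
    a complex with R_k (+) S_k in each degree k <= n (in degree n this uses the
    cap S_n).  Its differential sends ((s, p), t) to (d p, s), with d p read in
    the summand P_k of R_k, and it deformation retracts onto the capped complex
    ([expansion_retract0], [expansion_retractS]).  The same construction on the
    side of Q produces S_k (+) R_k in degree k.

    The two enlarged complexes are isomorphic ([expansion_iso]), by repeated
    use of Schanuel's lemma in the form [schanuel]: if two maps A -> N and
    B -> N from projective modules have the same image, then some isomorphism
    A (+) B -> B (+) A carries the first map, extended by 0, to the second one.
    In degree 0 the maps are the augmentations P_0 -> M and Q_0 -> M.  Once the
    isomorphism phi_k is built in degree k, it matches the two augmentations or
    differentials out of degree k, hence their kernels, and by exactness these
    are the images of the differentials R_(k+1) -> R_k (+) S_k and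
    S_(k+1) -> S_k (+) R_k; the lemma then gives phi_(k+1).

    The equivalence is the composite of the inclusion of one capped complex in
    its expansion, the isomorphism, and the projection to the other capped
    complex ([transfer]). *)

(** * Linear maps into a direct sum *)

Section Maps.
Variable R : pzRingType.

Definition map_pair (A B C : lmodType R) (f : {linear A -> B})
  (g : {linear A -> C}) (x : A) : (B * C)%type := (f x, g x).

Lemma map_pair_is_linear (A B C : lmodType R) (f : {linear A -> B})
  (g : {linear A -> C}) : linear (map_pair f g).
Proof. by move=> a x y; rewrite /map_pair !linearP. Qed.

HB.instance Definition _ (A B C : lmodType R) (f : {linear A -> B})
  (g : {linear A -> C}) :=
  GRing.isLinear.Build R A (B * C)%type _ (map_pair f g)
    (map_pair_is_linear f g).

End Maps.

Arguments map_pair {R A B C} f g x /.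

(** * Lifting and Schanuel's lemma *)

Section Pullback.
Variable R : pzRingType.
Variables (A B C : lmodType R) (f : {linear A -> C}) (g : {linear B -> C}).

Definition in_pullback := [pred x : (A * B)%type | f x.1 == g x.2].

Lemma in_pullback_submod : submod_closed in_pullback.
Proof.
split=> [|a x y]; rewrite !inE /= ?linear0 // => /eqP fgx /eqP fgy.
by rewrite !linearP fgx fgy.
Qed.

HB.instance Definition _ := GRing.isSubmodClosed.Build R (A * B)%type
  in_pullback in_pullback_submod.

Record pullback :=
  Pullback { pullback_val :> A * B; _ : in_pullback pullback_val }.

HB.instance Definition _ := [isSub for pullback_val].
HB.instance Definition _ := [Choice of pullback by <:].
HB.instance Definition _ := [SubChoice_isSubLmodule of pullback by <:].
End Pullback.

Section Projective.
Variable R : pzRingType.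

(** Projectivity speaks of lifting through surjections only, whereas here
    [f] need only reach the image of [g].  The projection to [P] of the pullback
    of [g] and [f] is surjective, so it has a section, whose second component
    is the lift. *)
Lemma projective_lift (P A C : lmodType R) (f : {linear A -> C})
    (g : {linear P -> C}) :
  projective P -> (forall x, exists a, f a = g x) ->
  exists h : {linear P -> A}, forall x, f (h x) = g x.
Proof.
move=> projP fg.
pose p1 : {linear pullback g f -> P} := fst \o (val : pullback g f -> P * A).
pose p2 : {linear pullback g f -> A} := snd \o (val : pullback g f -> P * A).
have p1_surj : surjective p1.
  move=> x; have [a /esym/eqP fax] := fg x.
  by exists (Pullback (pullback_val := (x, a)) fax).
have [h hK] := projP _ _ p1 idfun p1_surj.
exists (p2 \o h) => x; rewrite -[RHS]/(g (idfun x)) -hK /=.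
by case: (h x) => z /= /eqP.
Qed.

Lemma projective_prod (A B : lmodType R) :
  projective A -> projective B -> projective (A * B)%type.
Proof.
move=> projA projB X Y f g f_surj.
pose gA : {linear A -> Y} := g \o map_pair idfun \0.
pose gB : {linear B -> Y} := g \o map_pair \0 idfun.
have [hA hAE] := projA _ _ f gA f_surj.
have [hB hBE] := projB _ _ f gB f_surj.
exists (map_oplus hA hB) => -[a b].
rewrite /map_oplus /= linearD hAE hBE /gA /gB /= -linearD /=.
by congr (g _); congr pair; rewrite /= ?addr0 ?add0r.
Qed.

(** With [u] lifting [a] through [b] and [v] lifting [b] through [a], shearing
    [A * B] along [v] turns a (+) 0 into a (+) b, and then shearing along [u]
    leaves 0 (+) b.  After the swap of the factors, the composite of the two
    shears for [(u, v)] is inverse to the one for [(v, u)], which makes the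
    statement symmetric. *)
Lemma schanuel (A B N : lmodType R)
    (a : {linear A -> N}) (b : {linear B -> N}) :
    projective A -> projective B ->
    (forall x, exists y, b y = a x) -> (forall y, exists x, a x = b y) ->
  exists (phi : {linear (A * B)%type -> (B * A)%type})
      (psi : {linear (B * A)%type -> (A * B)%type}),
    [/\ cancel phi psi, cancel psi phi & forall z, b (phi z).1 = a z.1].
Proof.
move=> projA projB im_ab im_ba.
have [u uE] := projective_lift projA im_ab.
have [v vE] := projective_lift projB im_ba.
pose shear (C D : lmodType R) (s : {linear C -> D}) (t : {linear D -> C}) :
    {linear (C * D)%type -> (D * C)%type} :=
  let r := fst \- (t \o snd) in map_pair (snd \+ (s \o r)) r.
have shearK (C D : lmodType R) (s : {linear C -> D}) t :
    cancel (shear C D s t) (shear D C t s).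
  by case=> x y; rewrite /shear /= addrK subrK.
exists (shear A B u v), (shear B A v u); split; try exact: shearK.
by move=> [x y]; rewrite /= linearD uE linearB vE addrC subrK.
Qed.

End Projective.

(** * Dependent recursion below a bound *)

(** Turns an induction whose step only asserts existence into one family.
    Since just the indices up to [n] matter, the family is extended one value
    at a time from an arbitrary default [t0], so no choice is involved. *)
Lemma dependent_family (T : nat -> Type) (ok : forall k, T k -> Prop)
    (step : forall k, T k -> T k.+1 -> Prop) n :
  (forall k, T k) -> (exists x, ok 0%N x) ->
  (forall k x, (k < n)%N -> ok k x -> exists2 y, ok k.+1 y & step k x y) ->
  exists f : forall k, T k,
    (forall k, (k <= n)%N -> ok k (f k)) /\
    (forall k, (k < n)%N -> step k (f k) (f k.+1)).
Proof.
move=> t0 [x0 okx0]; elim: n => [|n IHn] next.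
  exists (dfwith t0 x0); split=> // k; rewrite leqn0 => /eqP->.
  by rewrite dfwith_in.
have [|f [okf stepf]] := IHn; first by move=> k x lt_kn; apply/next/ltnW.
have [y oky stepy] := next n (f n) (ltnSn n) (okf n (leqnn n)).
exists (dfwith f y).
have old k : (k <= n)%N -> dfwith f y k = f k.
  by move=> le_kn; rewrite dfwith_out // gtn_eqF.
split=> k; rewrite leq_eqVlt => /predU1P[].
- by move->; rewrite dfwith_in.
- by rewrite ltnS => le_kn; rewrite old //; apply: okf.
- by case=> ->; rewrite dfwith_in old.
by rewrite ltnS => lt_kn; rewrite !old // 1?ltnW //; apply: stepf.
Qed.

(** * The expanded complex *)

Section Stabilization.
Variable R : pzRingType.
Implicit Types P Q : nat -> lmodType R.

(** The alternating sums of the statement as one fixpoint: exchanging [P] and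
    [Q] exchanges the two families, so every lemma below about [P] also serves
    for [Q]. *)
Fixpoint stab P Q k : lmodType R :=
  if k is j.+1 then (stab Q P j * P j.+1)%type else P 0%N.

Lemma altRS_stab P Q k : altR P Q k = stab P Q k /\ altS P Q k = stab Q P k.
Proof. by elim: k => //= k [-> ->]. Qed.

Definition stab_in P Q k : {linear P k -> stab P Q k} :=
  if k is j.+1 then map_pair \0 idfun else idfun.

Definition stab_out P Q k : {linear stab P Q k -> P k} :=
  if k is j.+1 then snd else idfun.

Lemma stab_inK P Q k : cancel (stab_in P Q k) (stab_out P Q k).
Proof. by case: k. Qed.

Lemma projective_stab P Q n k :
  (forall i, (i <= n)%N -> projective (P i)) ->
  (forall i, (i <= n)%N -> projective (Q i)) ->
  (k <= n)%N -> projective (stab P Q k).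
Proof.
elim: k P Q => [|k IHk] P Q projP projQ le_kn; first exact: projP.
by apply: projective_prod; [apply/IHk/ltnW | apply: projP].
Qed.

Definition expansion P Q k : lmodType R := (stab P Q k * stab Q P k)%type.

Section Differential.
Variables (P Q : nat -> lmodType R) (d : forall i, {linear P i.+1 -> P i}).

(** The component out of R_(k+1) of the differential of the expansion, where
    R_(k+1) = S_k (+) P_(k+1).  It is kept separate because it is the map to
    which Schanuel's lemma applies; the differential vanishes on the other
    summand S_(k+1). *)
Definition stab_diff k : {linear stab P Q k.+1 -> expansion P Q k} :=
  map_pair (stab_in P Q k \o d k \o snd) fst.

Definition expansion_diff k : {linear expansion P Q k.+1 -> expansion P Q k} :=
  stab_diff k \o fst.

(** Moves the summand S_k in degree k to its copy inside
    R_(k+1) = S_k (+) P_(k+1): the contraction of the added trivial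
    complexes. *)
Definition contraction k : {linear expansion P Q k -> expansion P Q k.+1} :=
  map_pair (map_pair snd \0) \0.

Variables (n : nat) (M : lmodType R) (eps : {linear P 0%N -> M}).
Hypothesis exP : exact_seq n d eps.

(** This lemma and the next are the exactness of the expansion: the added
    trivial summands are exact, and the rest is the exactness of the sequence
    of [P]. *)
Lemma im_stab_diff0 (x : expansion P Q 0) : (0 < n)%N ->
  (exists y, stab_diff 0 y = x) <-> eps x.1 = 0.
Proof.
case: exP => _ ex0 _ /ex0{}ex0; case: x => p s; split.
  by case=> -[s' p'] [<- _]; apply/ex0; exists p'.
by case/ex0=> p' /= <-; exists (s, p').
Qed.

Lemma im_stab_diffS k (x : expansion P Q k.+1) : (k.+1 < n)%N ->
  (exists y, stab_diff k.+1 y = x) <-> expansion_diff k x = 0.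
Proof.
case: exP => _ _ exS /exS{}exS; case: x => -[s p] t; split.
  case=> -[t' p'] /= [<- <- _].
  by rewrite /stab_diff /= (proj2 (exS _)) ?linear0 //; exists p'.
rewrite /stab_diff /= => -[/(congr1 (stab_out P Q k))] /=.
by rewrite stab_inK linear0 => /exS[p' <-] ->; exists (t, p').
Qed.
End Differential.
End Stabilization.

(** * Isomorphism of the two expansions *)

Section Isos.
Variables (R : pzRingType) (P Q : nat -> lmodType R).
Variables (d : forall i, {linear P i.+1 -> P i}).
Variables (d' : forall i, {linear Q i.+1 -> Q i}).
Variables (n : nat) (M : lmodType R).
Variables (eps : {linear P 0%N -> M}) (eps' : {linear Q 0%N -> M}).
Hypotheses (exP : exact_seq n d eps) (exQ : exact_seq n d' eps').
Hypothesis projP : forall i, (i <= n)%N -> projective (P i).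
Hypothesis projQ : forall i, (i <= n)%N -> projective (Q i).

Let iso k := ({linear expansion P Q k -> expansion Q P k} *
              {linear expansion Q P k -> expansion P Q k})%type.

(* Matching the images, rather than the kernels, gives the invariant the same
   form in degree 0, where the next map is an augmentation, and in the other
   degrees.  Nothing is known about kernels in degree n, hence [k < n]. *)
Let ok k (f : iso k) := [/\ cancel f.1 f.2, cancel f.2 f.1 &
  (k < n)%N -> forall x, (exists y, stab_diff Q d k y = x) <->
                         (exists z, stab_diff P d' k z = f.1 x)].

Let step k (f : iso k) (g : iso k.+1) :=
  forall x, expansion_diff P d' k (g.1 x) = f.1 (expansion_diff Q d k x).

Lemma expansion_iso :
  exists (phi : forall k, {linear expansion P Q k -> expansion Q P k})
    (psi : forall k, {linear expansion Q P k -> expansion P Q k}),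
  (forall k, (k <= n)%N -> cancel (phi k) (psi k) /\ cancel (psi k) (phi k)) /\
  (forall k, (k < n)%N -> forall x,
     expansion_diff P d' k (phi k.+1 x) = phi k (expansion_diff Q d k x)).
Proof.
have [||| f [okf stepf]] := @dependent_family iso ok step n.
- by move=> k; split; exact: \0.
- have [||||phi [psi [phiK psiK phiE]]] := schanuel (a := eps) (b := eps').
  + exact: projP.
  + exact: projQ.
  + by move=> x; case: exQ => surj _ _; apply: surj.
  + by move=> x; case: exP => surj _ _; apply: surj.
  exists (phi, psi); split=> //= n_gt0 x.
  (* Both images are kernels of augmentations, which [phi] intertwines. *)
  apply: iff_trans (im_stab_diff0 exP _ n_gt0) _.
  by apply: iff_sym; rewrite -phiE; exact: (im_stab_diff0 exQ (phi x)).
- move=> k [phi psi] lt_kn [/= phiK psiK /(_ lt_kn) im_phi].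
  pose a : {linear stab P Q k.+1 -> expansion Q P k} := phi \o stab_diff Q d k.
  pose b := stab_diff P d' k.
  have [||||phi' [psi' [phiK' psiK' phiE]]] := schanuel (a := a) (b := b).
  + exact: (projective_stab projP projQ lt_kn).
  + exact: (projective_stab projQ projP lt_kn).
  + by move=> x; apply/im_phi; exists x.
  + move=> y; have [|x xE] := proj2 (im_phi (psi (b y))).
      by exists y; rewrite psiK.
    by exists x; rewrite /a /= xE psiK.
  exists (phi', psi') => //; split=> //= lt_k1n x.
  (* Both images are kernels of differentials, intertwined by [phi'] above
     the isomorphism [phi]. *)
  apply: iff_trans (im_stab_diffS exP _ lt_k1n) _.
  apply: iff_trans _ (iff_sym (im_stab_diffS exQ _ lt_k1n)).
  rewrite -[expansion_diff P d' k _]/(b (phi' x).1) phiE.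
  rewrite -[a x.1]/(phi (expansion_diff Q d k x)).
  split=> [->|]; first by rewrite linear0.
  by move/(congr1 psi); rewrite phiK linear0.
by exists (fun k => (f k).1), (fun k => (f k).2); split=> // k /okf[].
Qed.

End Isos.

(** * Coordinates on a capped complex *)

Section Capped.
Variable R : pzRingType.
Implicit Types (P T : nat -> lmodType R).

(** The terms of a capped complex are defined by recursion on [n], so their
    types depend on how [k] compares with [n].  This embedding, with its
    retraction [capped_out], gives all of them coordinates in [P k * T k],
    which allows computing without casts.  The cap is the value at [n] of a
    family [T] because the recursion shifts [P]: the cap must then still be
    found at the degree that is reached. *)
Fixpoint capped_in n P T k :
    {linear capped_term n P (T n) k -> (P k * T k)%type} :=
  match n, k with
  | 0, 0 => idfun
  | 0, _.+1 => \0
  | _.+1, 0 => map_pair idfun \0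
  | m.+1, j.+1 => capped_in m (fun i => P i.+1) (fun i => T i.+1) j
  end.

Fixpoint capped_out n P T k :
    {linear (P k * T k)%type -> capped_term n P (T n) k} :=
  match n, k with
  | 0, 0 => idfun
  | 0, _.+1 => \0
  | _.+1, 0 => fst
  | m.+1, j.+1 => capped_out m (fun i => P i.+1) (fun i => T i.+1) j
  end.

Lemma capped_gt n P S k (x : capped_term n P S k) : (n < k)%N -> x = 0.
Proof.
elim: n P k x => [|n IHn] P [|k] //= x; last exact: IHn.
by move=> _; apply: thinmx0.
Qed.

Lemma capped_inK n P T k : cancel (capped_in n P T k) (capped_out n P T k).
Proof.
elim: n P T k => [|n IHn] P T [|k] //= x; last exact: IHn.
by rewrite [x]thinmx0.
Qed.

Lemma capped_outK n P T k z : (k <= n)%N ->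
  capped_in n P T k (capped_out n P T k z) =
  (z.1, if (k < n)%N then 0 else z.2).
Proof.
elim: n P T k z => [|n IHn] P T [|k] //= z; last exact: IHn.
by case: z.
Qed.

Lemma capped_in_diff n P T (d : forall i, {linear P i.+1 -> P i}) k x :
  (k < n)%N ->
  capped_in n P T k (capped_diff n d (T n) k x) =
  (d k (capped_in n P T k.+1 x).1, 0).
Proof.
elim: n P T d k x => [|n IHn] P T d [|k] // x lt_kn.
  case: n IHn x lt_kn => [|n] _ x _ //=.
  by rewrite /map_oplus /= addr0.
by case: n IHn x lt_kn => // n IHn x lt_kn; apply: (IHn _ _ (fun i => d i.+1)).
Qed.
End Capped.

(** * Homotopies for complexes concentrated in degrees up to n *)

Section HomotopyCriteria.
Variable R : pzRingType.

Lemma bounded_chain_map n (C D : chain_complex R)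
    (u : forall k, {linear C k -> D k}) :
  (forall k (x : C k), (n < k)%N -> x = 0) ->
  (forall k x, (k < n)%N -> u k (cdiff C k x) = cdiff D k (u k.+1 x)) ->
  exists f : chain_map C D, forall k, f k = u k.
Proof.
move=> C_gt uE.
have uE' k x : u k (cdiff C k x) = cdiff D k (u k.+1 x).
  by case: (ltnP k n) => [/uE // | le_nk]; rewrite (C_gt _ x) // !linear0.
by exists (ChainMap uE').
Qed.

(** If [H] is a homotopy from [e] to the identity of [Y], truncated above degree
    [n], then conjugating by [u] and [v] gives one from [v e u] to the identity
    of [C], up to sign.  The family [Y] itself need not be truncated: the terms
    of [C] above [n] vanish, so the conjugated homotopy is automatically 0 in
    degree [n], which accounts for the tests against [n] in the two formulas
    for [y - e k y].  In the application [Y] is the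
    expansion of one sequence and [C] the capped complex of the other. *)
Lemma retract_homotopic n (C : chain_complex R) (Y : nat -> lmodType R)
    (dY : forall k, {linear Y k.+1 -> Y k})
    (H : forall k, {linear Y k -> Y k.+1})
    (e : forall k, Y k -> Y k)
    (u : forall k, {linear C k -> Y k}) (v : forall k, {linear Y k -> C k}) :
  (forall k (x : C k), (n < k)%N -> x = 0) ->
  (forall k, (k <= n)%N -> cancel (u k) (v k)) ->
  (forall k x, (k < n)%N -> u k (cdiff C k x) = dY k (u k.+1 x)) ->
  (forall k y, (k < n)%N -> v k (dY k y) = cdiff C k (v k.+1 y)) ->
  (forall y, y - e 0%N y = if (0 < n)%N then dY 0%N (H 0%N y) else 0) ->
  (forall k y, (k < n)%N -> y - e k.+1 y =
     (if (k.+1 < n)%N then dY k.+1 (H k.+1 y) else 0) + H k (dY k y)) ->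
  chain_homotopic (fun k x => v k (e k (u k x))) (fun k (x : C k) => x).
Proof.
move=> C_gt uK uE vE e0 eS; exists (fun k => \- (v k.+1 \o (H k \o u k))).
have vd k y : v k (if (k < n)%N then dY k y else 0) = cdiff C k (v k.+1 y).
  case: ifP => [/vE // | /negbT]; rewrite -leqNgt => le_nk.
  by rewrite [v _ y]C_gt // !linear0.
have eE k x : e k x = x - (x - e k x) by rewrite subKr.
split=> [x | k x] /=.
  by rewrite eE linearB uK // e0 vd linearN addrAC subrr sub0r.
case: (ltnP k n) => [lt_kn | le_nk]; last by rewrite [LHS]C_gt // [RHS]C_gt.
rewrite eE linearB uK // eS // linearD vd uE // linearN.
by rewrite addrAC subrr sub0r opprD.
Qed.
End HomotopyCriteria.

(** * The expansion retracts onto the capped complex *)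

Section Resolution.
Variables (R : pzRingType) (P Q : nat -> lmodType R) (n : nat).
Variables (d : forall i, {linear P i.+1 -> P i}) (M : lmodType R).
Variables (eps : {linear P 0%N -> M}) (exP : exact_seq n d eps).

Let C := capped_complex exP (stab Q P n).

Definition expansion_in k :
    {linear capped_term n P (stab Q P n) k -> expansion P Q k} :=
  map_pair (stab_in P Q k \o fst) snd \o capped_in n P (stab Q P) k.

Definition expansion_out k :
    {linear expansion P Q k -> capped_term n P (stab Q P n) k} :=
  capped_out n P (stab Q P) k \o map_pair (stab_out P Q k \o fst) snd.

Lemma expansion_inK k : cancel (expansion_in k) (expansion_out k).
Proof.
move=> x; rewrite /expansion_in /expansion_out /= stab_inK.
by rewrite -surjective_pairing capped_inK.
Qed.

Lemma expansion_in_diff k x : (k < n)%N ->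
  expansion_in k (cdiff C k x) = expansion_diff Q d k (expansion_in k.+1 x).
Proof.
move=> lt_kn; rewrite /expansion_in /expansion_diff /stab_diff /=.
by rewrite capped_in_diff.
Qed.

Lemma expansion_out_diff k y : (k < n)%N ->
  expansion_out k (expansion_diff Q d k y) = cdiff C k (expansion_out k.+1 y).
Proof.
move=> lt_kn; rewrite -[LHS]capped_inK -[RHS]capped_inK.
congr (capped_out _ _ _ _ _).
rewrite [in RHS]/C /= capped_in_diff // /expansion_out /=.
rewrite !capped_outK ?(ltnW lt_kn) //=.
by rewrite stab_inK lt_kn.
Qed.

Lemma expansion_outK k y : (k <= n)%N ->
  expansion_in k (expansion_out k y) =
  (stab_in P Q k (stab_out P Q k y.1), if (k < n)%N then 0 else y.2).
Proof.
by move=> le_kn; rewrite /expansion_in /expansion_out /= capped_outK.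
Qed.

(** The identity minus the retraction is dH + Hd with H the contraction.  In
    degree [n] the term dH is absent and the cap survives: there the summand
    S_n belongs to the capped complex and is not contracted. *)
Lemma expansion_retract0 y : y - expansion_in 0 (expansion_out 0 y) =
  if (0 < n)%N then expansion_diff Q d 0 (contraction P Q 0 y) else 0.
Proof.
rewrite expansion_outK //; case: y => p s /=.
case: ifP => _; last by rewrite subrr.
rewrite /expansion_diff /stab_diff /= linear0.
by congr pair; rewrite /= ?subrr ?subr0.
Qed.

Lemma expansion_retractS k y : (k < n)%N ->
  y - expansion_in k.+1 (expansion_out k.+1 y) =
  (if (k.+1 < n)%N then expansion_diff Q d k.+1 (contraction P Q k.+1 y) else 0)
  + contraction P Q k (expansion_diff Q d k y).
Proof.
move=> lt_kn; rewrite expansion_outK //; case: y => -[s p] t.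
rewrite /expansion_diff /stab_diff /contraction /= !linear0.
by case: ifP => _; congr pair; rewrite /= ?subr0 ?subrr ?add0r ?addr0 //;
   congr pair; rewrite /= ?subr0 ?subrr ?add0r ?addr0.
Qed.

End Resolution.

(** * The homotopy equivalence *)

Definition transfer (R : pzRingType) (P Q : nat -> lmodType R) n
    (phi : forall k, {linear expansion P Q k -> expansion Q P k}) k :
    {linear capped_term n P (stab Q P n) k -> capped_term n Q (stab P Q n) k} :=
  expansion_out Q P n k \o (phi k \o expansion_in P Q n k).

Section Transfer.
Variables (R : pzRingType) (P Q : nat -> lmodType R) (n : nat) (M : lmodType R).
Variables (d : forall i, {linear P i.+1 -> P i}) (eps : {linear P 0%N -> M}).
Variables (d' : forall i, {linear Q i.+1 -> Q i}) (eps' : {linear Q 0%N -> M}).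
Hypotheses (exP : exact_seq n d eps) (exQ : exact_seq n d' eps').

Let C := capped_complex exP (stab Q P n).
Let D := capped_complex exQ (stab P Q n).

Variable phi : forall k, {linear expansion P Q k -> expansion Q P k}.
Hypothesis phi_diff : forall k x, (k < n)%N ->
  phi k (expansion_diff Q d k x) = expansion_diff P d' k (phi k.+1 x).

Lemma transfer_chain_map :
  exists f : chain_map C D, forall k, f k = transfer n phi k.
Proof.
apply: (@bounded_chain_map _ n) => [k x|k x lt_kn]; first exact: capped_gt.
rewrite -[LHS]/(expansion_out Q P n k
  (phi k (expansion_in P Q n k (cdiff C k x)))).
rewrite (expansion_in_diff (exP := exP)) // phi_diff //.
by rewrite (expansion_out_diff exQ).
Qed.

Variable psi : forall k, {linear expansion Q P k -> expansion P Q k}.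
Hypothesis phiK : forall k, (k <= n)%N -> cancel (phi k) (psi k).
Hypothesis psi_diff : forall k y, (k < n)%N ->
  psi k (expansion_diff P d' k y) = expansion_diff Q d k (psi k.+1 y).

(** The composite of the two transfers passes through the expansion of [Q],
    where it meets the retraction onto the capped complex of [Q]; this is
    homotopic to the identity, and what is left when it is removed is
    [psi k \o phi k] between the inclusion and the projection. *)
Lemma transfer_homotopic : chain_homotopic (C := C) (D := C)
  (fun k x => transfer n psi k (transfer n phi k x)) (fun k x => x).
Proof.
pose u k : {linear C k -> expansion Q P k} := phi k \o expansion_in P Q n k.
pose v k : {linear expansion Q P k -> C k} := expansion_out P Q n k \o psi k.
apply: (@retract_homotopic _ n C _ (expansion_diff P d') (contraction Q P)
  (fun k y => expansion_in Q P n k (expansion_out Q P n k y)) u v).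
- by move=> k x; apply: capped_gt.
- move=> k le_kn x; rewrite -[LHS]/(expansion_out P Q n k (psi k (phi k _))).
  by rewrite phiK // expansion_inK.
- move=> k x lt_kn; rewrite -[LHS]/(phi k (expansion_in P Q n k (cdiff C k x))).
  by rewrite (expansion_in_diff (exP := exP)) // phi_diff.
- move=> k y lt_kn.
  rewrite -[LHS]/(expansion_out P Q n k (psi k _)) psi_diff //.
  by rewrite (expansion_out_diff exP).
- exact: expansion_retract0.
- exact: expansion_retractS.
Qed.

End Transfer.

Theorem theorem1p1p1 (R : pzRingType) (M : rmodType R) (n : nat)
    (P Q : nat -> rmodType R)
    (d : forall i, {linear P i.+1 -> P i}) (eps : {linear P 0%N -> M})
    (d' : forall i, {linear Q i.+1 -> Q i}) (eps' : {linear Q 0%N -> M})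
    (exP : exact_seq n d eps) (exQ : exact_seq n d' eps')
    (projP : forall i, (i <= n)%N -> projective (P i))
    (projQ : forall i, (i <= n)%N -> projective (Q i)) :
  homotopy_equivalent (capped_complex exP (altS P Q n))
                      (capped_complex exQ (altR P Q n)).
Proof.
have [-> ->] := altRS_stab P Q n.
have [phi [psi [phiK phi_diff]]] := expansion_iso exP exQ projP projQ.
have phi_diff' k x (lt_kn : (k < n)%N) := esym (phi_diff k lt_kn x).
have psi_diff k y : (k < n)%N ->
    psi k (expansion_diff P d' k y) = expansion_diff Q d k (psi k.+1 y).
  move=> lt_kn; have [_ psiK] := phiK k.+1 lt_kn.
  have [{}phiK _] := phiK k (ltnW lt_kn).
  by rewrite -[in LHS](psiK y) phi_diff // phiK.
have [f fE] := transfer_chain_map exP exQ phi_diff'.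
have [g gE] := transfer_chain_map exQ exP psi_diff.
exists f, g; split.
  have [h [h0 hS]] := transfer_homotopic exP phi_diff'
    (fun k le_kn => proj1 (phiK k le_kn)) psi_diff.
  by exists h; split=> *; rewrite fE gE ?h0 ?hS.
have [h [h0 hS]] := transfer_homotopic exQ psi_diff
  (fun k le_kn => proj2 (phiK k le_kn)) phi_diff'.
by exists h; split=> *; rewrite fE gE ?h0 ?hS.
Qed.
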